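(* Let $G$ be a graph which has no even cycles. Then the $\gamma$-polynomial of $h^*(\mathcal{A}_{\widehat{G}},x)$ coincides with the $f$-polynomial of a flag simplicial complex.
   Context: All graphs are finite and simple. For a graph $G$ on $[n]$, the suspension $\widehat{G}$ is the graph on $[n+1]$ with edge set $E(G)\cup\{\{i,n+1\}: i\in[n]\}$. For a graph $H$ on $[N]$, the symmetric edge polytope $\mathcal{A}_H\subset\mathbb{R}^N$ is the convex hull of $\{\pm(\mathbf{e}_i-\mathbf{e}_j): \{i,j\}\in E(H)\}$. For a lattice polytope $\mathcal{P}\subset\mathbb{R}^N$ of dimension $d$, $h^*(\mathcal{P},x)$ is defined by $1+\sum_{t\ge1}|t\mathcal{P}\cap\mathbb{Z}^N|x^t = h^*(\mathcal{P},x)/(1-x)^{d+1}$. The polytope $\mathcal{A}_{\widehat G}$ is reflexive of dimension $n$, so $h^*(\mathcal{A}_{\widehat G},x)$ is palindromic of degree $n$ and can be uniquely written as $\sum_{i}\gamma_i x^i(1+x)^{n-2i}$; its $\gamma$-polynomial is $\sum_i\gamma_ix^i$. A simplicial complex is flag if all its minimal non-faces have exactly two elements. The $f$-polynomial of a simplicial complex $\Delta$ is $\sum_{F\in\Delta}x^{|F|}$ (the empty face contributes $1$). *)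

(* Defs.v *)
From mathcomp Require Import all_boot all_order all_algebra finmap.
From mathcomp Require Import boolp classical_sets cardinality reals convex.

Set Implicit Arguments.
Unset Strict Implicit.
Unset Printing Implicit Defensive.

Import Order.TTheory GRing.Theory Num.Theory.

Local Open Scope classical_set_scope.
Local Open Scope ring_scope.

(* A graph on [n] is a symmetric irreflexive relation on 'I_n. The size bound
   in no_even_cycle is needed because [:: x; y] is a ucycle for every edge. *)
Definition no_even_cycle (T : finType) (e : rel T) : Prop :=
  forall c : seq T, ucycle e c -> (2 < size c)%N -> odd (size c).

Definition suspension n (e : rel 'I_n) : rel 'I_n.+1 := fun i j =>
  match unlift ord_max i, unlift ord_max j with
  | Some i', Some j' => e i' j'
  | None, None => false
  | _, _ => true
  end.

Section Polytopes.
Variables (R : realType) (N : nat).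

Definition convex_hull (V : set 'rV[R]_N) : set 'rV[R]_N :=
  smallest (@convex_set R 'rV[R]_N) V.

Definition sym_edge_polytope (e : rel 'I_N) : set 'rV[R]_N :=
  convex_hull [set v | exists i j, e i j /\
    (v = delta_mx 0 i - delta_mx 0 j \/ v = - (delta_mx 0 i - delta_mx 0 j))].

Definition affinely_independent k (X : 'I_k -> 'rV[R]_N) : Prop :=
  forall c : 'I_k -> R,
    \sum_i c i = 0 -> \sum_i c i *: X i = 0 -> forall i, c i = 0.

(* dim P + 1, as the largest number of affinely independent points of P;
   hence dim set0 = -1. *)
Definition dim_succ (P : set 'rV[R]_N) : nat :=
  \max_(k < N.+2 | `[< exists X : 'I_k -> 'rV[R]_N,
                        (forall i, P (X i)) /\ affinely_independent X >]) k.

Definition dilate_lattice_points (P : set 'rV[R]_N) (t : nat) :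
    set 'rV[int]_N :=
  [set z | [set t%:R *: x | x in P] (map_mx intr z)].

(* The coefficients of 1 + sum_(t >= 1) |tP cap Z^N| x^t. *)
Definition ehrhart_coef (P : set 'rV[R]_N) (t : nat) : int :=
  if t is 0%N then 1 else #|` fset_set (dilate_lattice_points P t) |%fset%:Z.

(* h = (1 - x)^(dim P + 1) * (1 + sum_(t >= 1) |tP cap Z^N| x^t) as formal
   power series, compared coefficient by coefficient; h is thus unique. *)
Definition is_hstar (P : set 'rV[R]_N) (h : {poly int}) : Prop :=
  forall k : nat,
    h`_k = \sum_(j < k.+1)
             ((1 - 'X : {poly int}) ^+ dim_succ P)`_j * ehrhart_coef P (k - j).

End Polytopes.

Arguments sym_edge_polytope R {N} e.

(* The size condition makes g unique. *)
Definition is_gamma (n : nat) (h g : {poly int}) : Prop :=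
  (size g <= n./2.+1)%N /\
  h = \sum_(i < n./2.+1) g`_i *: ('X^i * (1 + 'X) ^+ (n - i.*2)).

Section Complexes.
Variable T : finType.
Implicit Type D : {set {set T}}.

Definition simplicial_complex D : Prop :=
  finset.set0 \in D /\ forall A B : {set T}, B \in D -> A \subset B -> A \in D.

Definition minimal_nonface D (A : {set T}) : bool :=
  minset [pred B : {set T} | B \notin D] A.

Definition flag D : Prop :=
  forall A : {set T}, minimal_nonface D A -> (#|A| = 2)%N.

Definition f_poly D : {poly int} := \sum_(A in D) 'X^#|A|.

End Complexes.

(* Main.v *)
(* Dropping the apex coordinate turns the lattice points of the t-th dilate
   into the integer vectors z of gauge norm at most t, and the norm of z is the
   maximal |z|-weight of a set of vertices that is independent in the graph of
   the edges of G joining coordinates of opposite signs.  That graph is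
   bipartite, hence a forest, since G has no even cycles.  Removing leaves one
   by one shows that the vectors with negative set W have generating function
   m_W x^|W| / (1 - x)^n, where m_W counts the matchings of the forest.  Summing
   over W gives
     h^* = sum_M x^|M| (1 + x)^(n - 2|M|)
   over the sets M of pairwise vertex-disjoint oriented edges of G, and these
   sets form a flag complex. *)
Require Import Defs.
From mathcomp Require Import all_boot all_order all_algebra reals.
From mathcomp Require Import finmap boolp classical_sets cardinality convex.
From mathcomp Require Import interval_inference zify ring lra.

Set Implicit Arguments.
Unset Strict Implicit.
Unset Printing Implicit Defensive.

Import Order.TTheory GRing.Theory Num.Theory.

Local Open Scope classical_set_scope.
Local Open Scope ring_scope.

(** * Generating functions of graded sets *)

Section GeneratingFunctions.

(** The norm formula is a linear programming duality. A set [I] independent in the cut of [W] gives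
    the linear form [cut_form I W], which is at most 1 on the polytope and hence at most t on its
    t-th dilate. Conversely, leaf removal writes an integer vector as a sum of edge vectors whose
    number is exactly the maximal weight. The recursion [indep_norm_leaf] serves both there and in
    the count. Zero coordinates count as nonnegative: with [w] the indicator of the negative set
    [W], absolute values satisfy [w v <= a v], and each integer vector has exactly one [W]. This
    asymmetry is also what makes the numerators monomials. A cut edge satisfies [w l + w v = 1], so
    the two contributions of a leaf [l] with neighbour [v], namely [X^(w l)] times that of [S :\ l]
    and [X] times that of [S :\ l :\ v], carry the same power of [X], while their coefficients add
    up like matchings without and with the leaf edge. For a fixed set of disjoint darts, [W] must
    contain the heads and avoid the tails; every other vertex is free and gives a factor [1 + X]. *)

Definition eq_upto (m : nat) (p q : {poly int}) : Prop :=
  forall k, (k < m)%N -> p`_k = q`_k.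

Lemma eq_upto_mull m r p q : eq_upto m p q -> eq_upto m (r * p) (r * q).
Proof.
move=> pq k km; rewrite !coefM; apply: eq_bigr => i _.
by rewrite pq // (leq_ltn_trans _ km) // leq_subr.
Qed.

Definition level (U : choiceType) (A : set U) (N : U -> nat) (k : nat) : set U :=
  [set a | A a /\ N a = k].

Definition card_level (U : choiceType) (A : set U) (N : U -> nat) (k : nat) :=
  #|` fset_set (level A N k)|%fset.

Definition level_poly (U : choiceType) (A : set U) (N : U -> nat) (m : nat) :
    {poly int} := \poly_(i < m) (card_level A N i)%:Z.

(* [sum_(a in A) x ^ N a = p / (1 - x) ^ d] as formal power series. *)
Definition has_gf (U : choiceType) (A : set U) (N : U -> nat) (d : nat)
    (p : {poly int}) : Prop :=
  (forall k, finite_set (level A N k)) /\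
  forall m, eq_upto m ((1 - 'X) ^+ d * level_poly A N m) p.

Section Images.

Variables (U V : choiceType).

Lemma card_levelU (A B : set U) N k :
    finite_set (level A N k) -> finite_set (level B N k) ->
    A `&` B `<=` set0 ->
  card_level (A `|` B) N k = (card_level A N k + card_level B N k)%N.
Proof.
move=> fA fB AB; rewrite /card_level.
have -> : level (A `|` B) N k = level A N k `|` level B N k.
  apply/seteqP; split=> a; rewrite /level /=; last by case=> -[? ?]; split; auto.
  by case=> -[] ? ?; [left|right].
rewrite fset_setU // cardfsU -fset_setI //.
rewrite (_ : _ `&` _ = set0) ?fset_set0 ?cardfs0 ?subn0 //.
by apply/seteqP; split=> a //= -[[Aa _] [Ba _]]; case: (AB a).
Qed.

Lemma level_image (f : U -> V) (A : set U) N N' j k :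
    (forall a, A a -> N' (f a) = (j + N a)%N) ->
  level (f @` A) N' (j + k) = f @` level A N k.
Proof.
move=> Nf; apply/seteqP; split=> b /=.
  by case=> -[a Aa <-] /eqP; rewrite Nf // eqn_add2l => /eqP; exists a.
by case=> a [Aa Na] <-; split; [exists a|rewrite Nf // Na].
Qed.

Lemma level_image0 (f : U -> V) (A : set U) N N' j k :
    (forall a, A a -> N' (f a) = (j + N a)%N) -> (k < j)%N ->
  level (f @` A) N' k = set0.
Proof.
move=> Nf kj; apply/seteqP; split=> b //= -[[a Aa <-]]; rewrite Nf // => E.
by rewrite -E ltnNge leq_addr in kj.
Qed.

Lemma card_fset_set_image (f : U -> V) (A : set U) : finite_set A ->
    (forall a b, A a -> A b -> f a = f b -> a = b) ->
  #|` fset_set (f @` A)|%fset = #|` fset_set A|%fset.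
Proof.
move=> fA injf; rewrite fset_set_image // card_in_imfset //= => a b.
by rewrite !in_fset_set // !inE => Aa Ab; apply: injf.
Qed.

Lemma finite_level_image (f : U -> V) (A : set U) N N' j k :
    (forall a, A a -> N' (f a) = (j + N a)%N) ->
    (forall k, finite_set (level A N k)) ->
  finite_set (level (f @` A) N' k).
Proof.
move=> Nf fA; have [kj|jk] := ltnP k j; first by rewrite (level_image0 Nf kj).
by rewrite -(subnKC jk) (level_image _ Nf); apply: finite_image.
Qed.

Lemma level_poly_image (f : U -> V) (A : set U) N N' j m :
    (forall a b, A a -> A b -> f a = f b -> a = b) ->
    (forall a, A a -> N' (f a) = (j + N a)%N) ->
    (forall k, finite_set (level A N k)) ->
  eq_upto m (level_poly (f @` A) N' m) ('X^j * level_poly A N m).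
Proof.
move=> injf Nf fA k km; rewrite coefXnM !coef_poly km /card_level.
have [kj|jk] := ltnP k j; first by rewrite (level_image0 Nf kj) fset_set0.
rewrite (leq_ltn_trans (leq_subr _ _) km).
rewrite -{1}(subnKC jk) (level_image _ Nf) card_fset_set_image //.
by move=> a b [Aa _] [Ab _]; apply: injf.
Qed.

Lemma has_gfU (A B : set U) N d p q :
    A `&` B `<=` set0 -> has_gf A N d p -> has_gf B N d q ->
  has_gf (A `|` B) N d (p + q).
Proof.
move=> AB [fA gA] [fB gB]; split=> [k|m k km].
  apply: (@sub_finite_set _ _ (level A N k `|` level B N k)).
    by move=> a [[] ? ?]; [left|right].
  by rewrite finite_setU.
rewrite coefD -(gA m) // -(gB m) // -coefD -mulrDr.
apply: eq_upto_mull (km) => i _; rewrite coefD !coef_poly; case: ifP => // _.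
by rewrite card_levelU // PoszD.
Qed.

Lemma has_gf_image (f : U -> V) (A : set U) N N' j d p :
    (forall a b, A a -> A b -> f a = f b -> a = b) ->
    (forall a, A a -> N' (f a) = (j + N a)%N) ->
  has_gf A N d p -> has_gf (f @` A) N' d ('X^j * p).
Proof.
move=> injf Nf [fA gA]; split=> [k|m k km]; first exact: finite_level_image _ Nf fA.
rewrite (eq_upto_mull _ (level_poly_image injf Nf fA)) //.
by rewrite mulrCA (eq_upto_mull _ (gA m)).
Qed.

End Images.

Variable U : choiceType.

(* If [A] splits into [B] and a copy of itself shifted by one level, its
   generating function is that of [B] divided by [1 - x]. *)
Lemma has_gf_step (f : U -> U) (A B : set U) N d p :
    (forall a b, A a -> A b -> f a = f b -> a = b) ->
    (forall a, A a -> N (f a) = (N a).+1) ->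
    A = B `|` f @` A -> B `&` f @` A `<=` set0 ->
  has_gf B N d p -> has_gf A N d.+1 p.
Proof.
move=> injf Nf Adef AB [fB gB].
have Nf1 a : A a -> N (f a) = (1 + N a)%N by apply: Nf.
have levelA k : level A N k `<=` level B N k `|` level (f @` A) N k.
  by move=> a /= [Aa Na]; move: Aa; rewrite {1}Adef => -[]; [left|right].
have fA : forall k, finite_set (level A N k).
  elim=> [|k IH]; apply: (sub_finite_set (levelA _)).
    by rewrite (level_image0 Nf1) // setU0.
  by rewrite finite_setU -add1n (level_image _ Nf1); split=> //; apply: finite_image.
have ffA k : finite_set (level (f @` A) N k) by exact: finite_level_image _ Nf1 fA.
split=> // m k km; rewrite -(gB m) // exprSr -mulrA.
apply: eq_upto_mull (km) => {km}i im.
rewrite mulrBl mul1r coefB -[in 'X * _](expr1 'X).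
rewrite -(level_poly_image injf Nf1 fA im) !coef_poly im.
by rewrite {1}Adef card_levelU // PoszD addrK.
Qed.

Lemma has_gf_set1 (a : U) N : N a = 0%N -> has_gf [set a] N 0 1.
Proof.
move=> Na; have lev k : level [set a] N k = if k == 0%N then [set a] else set0.
  apply/seteqP; split=> b; rewrite /level /=.
    by case=> -> <-; rewrite Na.
  by case: eqP => // -> /= ->.
split=> [k|m k km]; first by rewrite lev; case: ifP.
rewrite expr0 mul1r coef_poly km /card_level lev coef1.
by case: eqP => _; rewrite ?fset_set1 ?cardfs1 ?fset_set0 ?cardfs0.
Qed.

End GeneratingFunctions.

(** The index will be the sign pattern [W]; since the cut changes with [W], the norm must be allowed
    to depend on the index. *)
Lemma has_gf_sigma (I : finType) (U : choiceType) (A : I -> set U)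
    (N : I -> U -> nat) d (p : I -> {poly int}) :
    (forall i, has_gf (A i) (N i) d (p i)) ->
  has_gf [set u : I * U | A u.1 u.2] (fun u => N u.1 u.2) d (\sum_i p i).
Proof.
move=> gA.
suff gs (s : seq I) : uniq s -> has_gf [set u : I * U | u.1 \in s /\ A u.1 u.2]
    (fun u => N u.1 u.2) d (\sum_(i <- s) p i).
  have := gs _ (enum_uniq I); rewrite big_enum /=; congr has_gf.
  by apply/seteqP; split=> -[i u] /=; rewrite mem_enum //; case.
elim: s => [_|i s IH /= /andP[iNs us]].
  have lev k : level [set u : I * U | u.1 \in [::] /\ A u.1 u.2]
      (fun u => N u.1 u.2) k = set0.
    by rewrite -subset0 => u /= [[+ _] _]; rewrite in_nil.
  split=> [k|m k km]; first by rewrite lev.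
  rewrite big_nil (_ : level_poly _ _ _ = 0) ?mulr0 //.
  apply/polyP => j; rewrite coef_poly coef0 /card_level lev fset_set0.
  by rewrite cardfs0; case: ifP.
rewrite big_cons.
have -> : [set u : I * U | u.1 \in i :: s /\ A u.1 u.2] =
    (pair i @` A i) `|` [set u : I * U | u.1 \in s /\ A u.1 u.2].
  apply/seteqP; split=> -[j u] /=; rewrite inE.
    by case=> /orP[/eqP-> ?|]; [left; exists u|right].
  by case=> [[u' Au' [<- <-]]|[-> ?]]; rewrite ?eqxx ?orbT.
apply: has_gfU; last exact: IH.
  by move=> -[j u] /= [[u' _ [<- _]] []]; rewrite (negPf iNs).
rewrite -[p i]mul1r -(expr0 'X); apply: has_gf_image (gA i) => //.
by move=> a b _ _ [].
Qed.

(** * Weighted independent sets *)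

Section IndependentSetNorm.

Variables (T : finType) (b : rel T).
Implicit Types (a : T -> nat) (I : {set T}).

Definition indep I := [forall u in I, forall v in I, ~~ b u v].

Lemma indepP I : reflect {in I &, forall u v, ~~ b u v} (indep I).
Proof.
apply: (iffP forall_inP) => H u; first by move=> v uI; exact: (forall_inP (H u uI)).
by move=> uI; apply/forall_inP => v; exact: H.
Qed.

Definition indep_norm a : nat := \max_(I | indep I) (\sum_(v in I) a v)%N.

Definition upd a l x : T -> nat := fun u => if u == l then x else a u.

Lemma sum_indep_le a I : indep I -> (\sum_(v in I) a v <= indep_norm a)%N.
Proof. by move=> iI; rewrite /indep_norm (bigD1 I) //= leq_maxl. Qed.

Lemma indep_norm_le a k :
    (forall I, indep I -> (\sum_(v in I) a v <= k)%N) ->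
  (indep_norm a <= k)%N.
Proof. by move=> H; apply/bigmax_leqP. Qed.

Lemma le_indep_norm a I k : indep I ->
  (k <= \sum_(v in I) a v)%N -> (k <= indep_norm a)%N.
Proof. by move=> iI /leq_trans; apply; apply: sum_indep_le. Qed.

Let sum_delta (l : T) k : (\sum_u (if u == l then k else 0))%N = k.
Proof. by rewrite -big_mkcond big_pred1_eq. Qed.

Hypothesis b_sym : symmetric b.
Hypothesis b_irr : irreflexive b.

Lemma indep_norm0 : indep_norm (fun=> 0%N) = 0%N.
Proof.
by apply/eqP; rewrite -leqn0; apply: indep_norm_le => I _; rewrite big1.
Qed.

Lemma indepU1 l I : indep I -> (forall u, u \in I -> ~~ b l u) ->
  indep (l |: I)%SET.
Proof.
move=> /indepP iI lI; apply/indepP => u v.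
rewrite !inE => /predU1P[->|uI] /predU1P[->|vI]; rewrite ?b_irr ?lI //.
  by rewrite b_sym lI.
exact: iI.
Qed.

Lemma indepS I (J : {set T}) : J \subset I -> indep I -> indep J.
Proof.
by move=> /fintype.subsetP JI /indepP iI; apply/indepP => u v /JI uI /JI vI; apply: iI.
Qed.

Lemma add_indep_norm_le c a k :
    (forall I, indep I -> (c + \sum_(v in I) a v <= k)%N) ->
  (c + indep_norm a <= k)%N.
Proof.
move=> H; have ck : (c <= k)%N.
  apply: leq_trans (H finset.set0 _); first by rewrite leq_addr.
  by apply/indepP => u; rewrite inE.
by rewrite -leq_subRL //; apply: indep_norm_le => I iI; rewrite leq_subRL // H.
Qed.

(** Charging the constant to a vertex of choice reduces the comparisons of weights below to one
    vertex at a time. *)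
Let sum_add_delta (l : T) c I a :
  (c + \sum_(v in I) a v =
   \sum_u ((if u == l then c else 0) + (if u \in I then a u else 0)))%N.
Proof. by rewrite big_split /= sum_delta -big_mkcond. Qed.

Lemma indep_norm_isolated a l : (forall u, b l u -> a u = 0%N) ->
  indep_norm a = (a l + indep_norm (upd a l 0%N))%N.
Proof.
move=> al; apply/eqP; rewrite eqn_leq; apply/andP; split.
  apply: indep_norm_le => I iI.
  apply: leq_trans (leq_add (leqnn _) (sum_indep_le _ iI)).
  rewrite (sum_add_delta l) big_mkcond leq_sum // => u _; rewrite /upd.
  by case: eqP => [->|_]; case: (_ \in I); lia.
apply: add_indep_norm_le => I iI.
(* Neighbours of [l] have weight 0, so dropping the weightless vertices of [I] costs nothing and
   makes room for [l]. *)
pose J := (l |: [set u in I | a u != 0%N])%SET.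
apply: (@le_indep_norm _ J).
  apply: indepU1; first by apply: indepS iI; apply/fintype.subsetP => u; rewrite inE => /andP[].
  by move=> u; rewrite inE => /andP[_]; apply: contraNN => /al ->.
rewrite (sum_add_delta l) [X in (_ <= X)%N]big_mkcond leq_sum // => u _.
rewrite /upd !inE; case: eqP => [->|_] /=; first by case: ifP; lia.
by case: (_ \in I) => //=; case: eqP => [->|].
Qed.

(* An optimal independent set may be assumed to meet [{l, v}], so the weight
   [a l] is always collected and preferring [v] to [l] gains [a v - a l]
   (truncated: it is never needed when [a v <= a l]). *)
Lemma indep_norm_leaf a l v : b l v ->
    (forall u, b l u -> u != v -> a u = 0%N) ->
  indep_norm a = (a l + indep_norm (upd (upd a v (a v - a l)) l 0))%N.
Proof.
move=> blv al; have vl : v != l by apply: contraTneq blv => ->; rewrite b_irr.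
apply/eqP; rewrite eqn_leq; apply/andP; split.
  apply: indep_norm_le => I iI.
  apply: leq_trans (leq_add (leqnn _) (sum_indep_le _ iI)).
  (* If [l] is in [I], then [v] is not, and [a l] is charged to [l]; otherwise it is charged to [v],
     where [a v <= a l + (a v - a l)]. *)
  rewrite (sum_add_delta (if l \in I then l else v)) big_mkcond leq_sum // => u _.
  rewrite /upd; have [lI|lI] := boolP (l \in I).
    have vI : v \notin I by apply: contraL blv => vI; move/indepP: iI; apply.
    case: (eqVneq u l) => [->|ul]; first by rewrite lI leq_addr.
    by case: (eqVneq u v) => [->|uv]; rewrite ?(negPf vI).
  case: (eqVneq u l) => [->|ul]; first by rewrite (negPf lI) leq0n.
  by case: (eqVneq u v) => [->|uv]; case: ifP; lia.
apply: add_indep_norm_le => I iI.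
have [/andP[vI alv]|nvI] := boolP ((v \in I) && (a l <= a v)%N).
  apply: (le_indep_norm iI).
  rewrite (sum_add_delta v) [X in (_ <= X)%N]big_mkcond leq_sum // => u _.
  rewrite /upd; case: (eqVneq u v) => [->|uv].
    by rewrite vI (negPf vl); lia.
  by case: eqP => // _; case: ifP.
(* Here [v] is outside [I] or [a v < a l], so the truncated gain at [v] contributes nothing and [v]
   can be exchanged for [l]. *)
pose J := (l |: [set u in I | (a u != 0%N) && (u != v)])%SET.
apply: (@le_indep_norm _ J).
  apply: indepU1; first by apply: indepS iI; apply/fintype.subsetP => u; rewrite inE => /andP[].
  by move=> u; rewrite inE => /and3P[_ au uv]; apply: contraNN au => /al ->.
rewrite (sum_add_delta l) [X in (_ <= X)%N]big_mkcond leq_sum // => u _.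
rewrite /upd !inE; case: (eqVneq u l) => [->|ul] /=; first by case: ifP; lia.
case: (eqVneq u v) => [uv|uv]; last by case: (_ \in I) => //=; case: eqP => [->|].
by move: nvI; rewrite uv; case: (_ \in I) => //=; lia.
Qed.

End IndependentSetNorm.

(** * Generating function of a forest *)

Section ForestGeneratingFunction.

Variables (T : finType) (b : rel T) (w : T -> nat) (m : {set T} -> nat).
Implicit Types (a : T -> nat) (S : {set T}).

Hypothesis b_sym : symmetric b.
Hypothesis b_irr : irreflexive b.
Hypothesis b_w : forall u v, b u v -> (w u + w v = 1)%N.

Definition adm S : set (T -> nat) :=
  [set a | forall u : T, if u \in S then is_true (w u <= a u)%N else a u = 0%N].

Definition isolated S l := forall u, u \in S -> ~~ b l u.
Definition leaf S l v := [/\ v \in S, b l v & forall u, u \in S -> b l u -> u = v].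

Let N := indep_norm b.

Lemma adm_isolated S l a : isolated S l -> adm S a ->
  N a = (a l + N (upd a l 0%N))%N.
Proof.
move=> lS Sa; apply: indep_norm_isolated => // u blu.
by move: (Sa u); case: ifP => // /lS; rewrite blu.
Qed.

Lemma adm_leaf S l v a : leaf S l v -> adm S a ->
  N a = (a l + N (upd (upd a v (a v - a l)) l 0))%N.
Proof.
move=> [vS blv lS] Sa; apply: indep_norm_leaf => // u blu uv.
by move: (Sa u); case: ifP => // /lS /(_ blu) uv'; rewrite uv' eqxx in uv.
Qed.

(** Raising the value at [l] by one raises the norm by one, and the vectors tight at [l] are a copy
    of those on [S :\ l], shifted by [w l] levels. *)
Lemma adm_gf_isolated S l d p : l \in S -> isolated S l ->
  has_gf (adm (S :\ l)) N d p -> has_gf (adm S) N d.+1 ('X^(w l) * p).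
Proof.
move=> lS iS gS.
pose f a := upd a l (a l).+1; pose g a := upd a l (w l).
have Nf a : adm S a -> N (f a) = (N a).+1.
  move=> Sa; rewrite (adm_isolated iS Sa) (@adm_isolated S l (f a)) //.
    rewrite /f {1}/upd eqxx addSn; congr (_ + N _).+1.
    by apply/funext => u; rewrite /upd; case: eqP.
  by move=> u; move: (Sa u); rewrite /f /upd; case: (eqVneq u l) => [->|//]; rewrite lS; lia.
have Ng a : adm (S :\ l) a -> N (g a) = (w l + N a)%N.
  move=> Sa; rewrite (@adm_isolated S l (g a)) //.
    rewrite /g {1}/upd eqxx; congr (_ + N _)%N.
    apply/funext => u; rewrite /upd; case: eqP => // ->.
    by move: (Sa l); rewrite !inE eqxx.
  move=> u; move: (Sa u); rewrite /g /upd !inE; case: (eqVneq u l) => [->|//].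
  by rewrite lS.
apply: (@has_gf_step _ f _ (g @` adm (S :\ l))) => //.
- move=> a a' _ _ faa'; apply/funext => u; move: (congr1 (fun h => h u) faa').
  by rewrite /f /upd; case: (eqVneq u l) => [->|] // -[].
- apply/seteqP; split=> a.
    move=> Sa; have [al|al] := eqVneq (a l) (w l).
      left; exists (upd a l 0%N).
        move=> u; move: (Sa u); rewrite /upd !inE.
        by case: (eqVneq u l).
      by apply/funext => u; rewrite /g /upd; case: (eqVneq u l) => // ->.
    right; exists (upd a l (a l).-1).
      move=> u; move: (Sa u); rewrite /upd.
      by case: (eqVneq u l) => // ->; rewrite lS; lia.
    apply/funext => u; rewrite /f /upd eqxx; case: (eqVneq u l) => // ->.
    by move: (Sa l); rewrite lS; lia.
  case=> -[a' Sa' <-] u; move: (Sa' u); rewrite ?inE /f /g /upd.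
    by case: (eqVneq u l) => [->|_]; rewrite ?lS.
  by case: (eqVneq u l) => [->|_] //; rewrite lS; lia.
- move=> a [[a' Sa' <-] [a'' Sa'' /(congr1 (fun h => h l))]].
  by rewrite /f /g /upd !eqxx; move: (Sa'' l); rewrite lS; lia.
- apply: has_gf_image gS => // a a' Sa Sa' /(congr1 (fun h => h _)) aa'.
  apply/funext => u; move: (aa' u) (Sa l) (Sa' l); rewrite /g /upd !inE eqxx /=.
  by case: (eqVneq u l) => [->|] // _ -> ->.
Qed.

(* Admissible [a] either exceed the lower bounds both at the leaf [l] and at
   its neighbour [v], and are then shifts along the edge, or are tight at [l]
   (second part, [g]), or are tight at [v] with [a l > 0] (third part, [Z]). *)
Lemma adm_gf_leaf S l v d p q : l \in S -> leaf S l v ->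
    has_gf (adm (S :\ l)) N d.+1 p -> has_gf (adm (S :\ l :\ v)) N d q ->
  has_gf (adm S) N d.+2 ('X^(w l) * p + 'X * q).
Proof.
move=> lS lf gSl gSlv; have [vS blv _] := lf.
have wlv := b_w blv.
have vl : v != l by apply: contraTneq blv => ->; rewrite b_irr.
have Sl a : adm S a -> (w l <= a l)%N by move=> /(_ l); rewrite lS.
have Sv a : adm S a -> (w v <= a v)%N by move=> /(_ v); rewrite vS.
have Sl0 a : adm (S :\ l) a -> a l = 0%N by move=> /(_ l); rewrite !inE eqxx.
have Slv a : adm (S :\ l) a -> (w v <= a v)%N by move=> /(_ v); rewrite !inE vl vS.
have Slv0 a : adm (S :\ l :\ v) a -> a l = 0%N /\ a v = 0%N.
  by move=> Sa; move: (Sa l) (Sa v); rewrite !inE !eqxx andbF.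
pose f a := upd (upd a l (a l).+1) v (a v).+1.
(* Adding [w l] at [v] cancels the truncated subtraction in the leaf formula, so the norm grows by
   exactly [w l]. *)
pose g a := upd (upd a l (w l)) v (a v + w l).
pose Z := [set a | [/\ adm S a, a v = w v & (0 < a l)%N]].
(* On [Z] the difference [a v - a l] truncates to 0, because [a v = w v <= 1 <= a l]. Hence [a l]
   grows freely from its least value 1, which [h] installs. *)
pose f' a := upd a l (a l).+1.
pose h a := upd (upd a l 1) v (w v).
have updl a x y : upd (upd a l x) v y l = x by rewrite /upd eqxx eq_sym (negPf vl).
have updv a x y : upd (upd a l x) v y v = y by rewrite /upd eqxx.
have updu a x y u : u != l -> u != v -> upd (upd a l x) v y u = a u.
  by rewrite /upd => /negPf-> /negPf->.
have updlu a x u : u != l -> upd a l x u = a u by rewrite /upd => /negPf->.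
have fun3 a a' : a l = a' l -> a v = a' v ->
    (forall u, u != l -> u != v -> a u = a' u) -> a = a'.
  move=> al av au; apply/funext => u; have [->//|ul] := eqVneq u l.
  by have [->//|uv] := eqVneq u v; apply: au.
have adm3 S' a : (if l \in S' then w l <= a l else a l == 0)%N ->
    (if v \in S' then w v <= a v else a v == 0)%N ->
    (forall u, u != l -> u != v -> if u \in S' then is_true (w u <= a u)%N else a u = 0%N) ->
    adm S' a.
  move=> al av au u; have [->|ul] := eqVneq u l; first by move: al; case: ifP => // _ /eqP.
  have [->|uv] := eqVneq u v; first by move: av; case: ifP => // _ /eqP.
  exact: au.
have Sf a : adm S a -> adm S (f a).
  move=> Sa; apply: adm3; rewrite /f ?updl ?updv ?lS ?vS; try by move: (Sl _ Sa) (Sv _ Sa); lia.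
  by move=> u ul uv; rewrite updu //; apply: Sa.
have Sg a : adm (S :\ l) a -> adm S (g a).
  move=> Sa; apply: adm3; rewrite /g ?updl ?updv ?lS ?vS //; first by move: (Slv _ Sa); lia.
  by move=> u ul uv; rewrite updu //; move: (Sa u); rewrite !inE ul.
have Zh a : adm (S :\ l :\ v) a -> Z (h a).
  move=> Sa; rewrite /h; split; rewrite ?updl ?updv //.
  apply: adm3; rewrite ?updl ?updv ?lS ?vS //; first by lia.
  by move=> u ul uv; rewrite updu //; move: (Sa u); rewrite !inE ul uv.
have Sf' a : adm S a -> adm S (f' a).
  move=> Sa u; move: (Sa u); rewrite /f' /upd; case: (eqVneq u l) => [->|//].
  by rewrite lS; lia.
have Nf a : adm S a -> N (f a) = (N a).+1.
  move=> Sa; rewrite (adm_leaf lf Sa) (adm_leaf lf (Sf _ Sa)) /f updl updv addSn subSS.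
  congr (_ + N _).+1; apply: fun3; rewrite ?updl /upd ?eqxx ?(negPf vl) //.
  by move=> u /negPf-> /negPf->.
have Ng a : adm (S :\ l) a -> N (g a) = (w l + N a)%N.
  move=> Sa; rewrite (adm_leaf lf (Sg _ Sa)) /g updl updv addnK.
  congr (_ + N _)%N; apply: fun3; rewrite /upd ?eqxx ?(negPf vl) ?(Sl0 _ Sa) //.
  by move=> u /negPf-> /negPf->.
have Nf' a : Z a -> N (f' a) = (N a).+1.
  move=> [Sa av al]; rewrite (adm_leaf lf Sa) (adm_leaf lf (Sf' _ Sa)) /f'.
  rewrite {1}/upd eqxx addSn; congr (_ + N _).+1.
  apply: fun3; rewrite /upd ?eqxx ?(negPf vl) //; first by lia.
  by move=> u /negPf-> /negPf->.
have Nh a : adm (S :\ l :\ v) a -> N (h a) = (1 + N a)%N.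
  move=> Sa; have [Sh hv hl] := Zh _ Sa; rewrite (adm_leaf lf Sh) /h updl updv.
  congr (_ + N _)%N; have [al av] := Slv0 _ Sa; apply: fun3; rewrite /upd ?eqxx ?(negPf vl) ?al ?av //.
    by lia.
  by move=> u /negPf-> /negPf->.
have inj3 (k : (T -> nat) -> (T -> nat)) a a' : k a = k a' ->
    (forall c u, u != l -> u != v -> k c u = c u) ->
    a l = a' l -> a v = a' v -> a = a'.
  move=> kaa' kc al av; apply: fun3 => // u ul uv.
  by rewrite -(kc a u) // kaa' kc.
have gZ : has_gf Z N d.+1 ('X * q).
  apply: (@has_gf_step _ f' _ (h @` adm (S :\ l :\ v))) => //.
  - move=> a a' _ _ faa'; apply/funext => u; move: (congr1 (fun h => h u) faa').
    by rewrite /f' /upd; case: (eqVneq u l) => [->|] // -[].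
  - apply/seteqP; split=> a.
      move=> [Sa av al]; have [al1|al1] := eqVneq (a l) 1%N.
        left; exists (upd (upd a l 0) v 0)%N.
          apply: adm3; rewrite ?updl ?updv ?inE ?eqxx ?andbF //.
          by move=> u ul uv; rewrite updu // !inE ul uv; apply: Sa.
        by apply: fun3; rewrite /h ?updl ?updv // => u ul uv; rewrite !updu.
      right; exists (upd a l (a l).-1).
        split; rewrite ?(updlu _ _ _ vl) //; last by rewrite /upd eqxx; lia.
        apply: adm3; rewrite ?lS ?vS ?(updlu _ _ _ vl) ?Sv //; first by rewrite /upd eqxx; lia.
        by move=> u ul uv; rewrite updlu //; apply: Sa.
      by apply/funext => u; rewrite /f' /upd eqxx; case: (eqVneq u l) => // ->; lia.
    case=> -[a' Sa' <-]; first exact: Zh.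
    by case: Sa' => Sa' av al; split; [exact: Sf'|rewrite /f' (updlu _ _ _ vl)|rewrite /f' /upd eqxx].
  - move=> a [[a' _ <-] [a'' [_ _ al] /(congr1 (fun k => k l))]].
    by rewrite /f' /h updl /upd eqxx; lia.
  - apply: (has_gf_image _ Nh gSlv) => a a' Sa Sa' haa'.
    have [al av] := Slv0 _ Sa; have [al' av'] := Slv0 _ Sa'.
    by apply: (inj3 _ _ _ haa'); rewrite ?al ?av ?al' ?av' // => c u ul uv;
      rewrite /h updu.
apply: (@has_gf_step _ f _ (g @` adm (S :\ l) `|` Z)) => //.
- move=> a a' _ _ faa'; have fl := congr1 (fun k => k l) faa'.
  have fv := congr1 (fun k => k v) faa'; move: fl fv.
  rewrite /f !updl !updv => -[al] [av]; apply: (inj3 _ _ _ faa') => //.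
  by move=> c u ul uv; rewrite /f updu.
- apply/seteqP; split=> a.
    move=> Sa; have alw := Sl _ Sa; have avw := Sv _ Sa.
    have [/andP[al av]|na] := boolP ((w l < a l) && (w v < a v))%N.
      right; exists (upd (upd a l (a l).-1) v (a v).-1).
        apply: adm3; rewrite ?lS ?vS ?updl ?updv; try lia.
        by move=> u ul uv; rewrite updu //; apply: Sa.
      apply: fun3; rewrite /f ?updl ?updv; try lia.
      by move=> u ul uv; rewrite !updu.
    (* As [w l + w v = 1], the condition [0 < a v] means [w v + w l <= a v], which is what the image
       of [g] requires. *)
    left; have [/andP[/eqP al av]|na'] := boolP ((a l == w l) && (0 < a v))%N.
      left; exists (upd (upd a l 0) v (a v - w l)%N).
        apply: adm3; rewrite ?inE ?eqxx ?vl ?vS ?updl ?updv // /=; first by lia.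
        by move=> u ul uv; rewrite updu // !inE ul; apply: Sa.
      apply: fun3; rewrite /g ?updl ?updv //; first by lia.
      by move=> u ul uv; rewrite !updu.
    by right; split=> //; lia.
  case=> [[[a' Sa' <-]|[]//]|[a' Sa' <-]]; [exact: Sg|exact: Sf].
- move=> a [+ [a'' Sa'' fa'']]; have := Sl _ Sa''; have := Sv _ Sa''.
  move=> a'v a'l [[a' Sa' ga']|[_ av _]].
    by move/(congr1 (fun k => k l)): fa''; rewrite -ga' /f /g !updl; lia.
  by move/(congr1 (fun k => k v)): fa''; rewrite av /f !updv; lia.
- apply: has_gfU => //.
    move=> a [[a' Sa' <-] [_]]; rewrite /g updl updv; have := Slv _ Sa'; lia.
  apply: (has_gf_image _ Ng gSl) => a a' Sa Sa' gaa'.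
  have gv := congr1 (fun k => k v) gaa'; move: gv; rewrite /g !updv => /eqP.
  rewrite eqn_add2r => /eqP av; apply: (inj3 _ _ _ gaa') => //.
    by move=> c u ul uv; rewrite /g updu.
  by rewrite (Sl0 _ Sa) (Sl0 _ Sa').
Qed.

Hypothesis b_forest : forall S, S != finset.set0 ->
  exists2 l, l \in S & {in S &, forall u v, b l u -> b l v -> u = v}.
Hypothesis m0 : m finset.set0 = 1%N.
Hypothesis m_isolated : forall S l, l \in S -> isolated S l -> m S = m (S :\ l)%SET.
Hypothesis m_leaf : forall S l v, l \in S -> leaf S l v ->
  (m S = m (S :\ l)%SET + m (S :\ l :\ v)%SET)%N.

Lemma forest_cases S : S != finset.set0 ->
  exists2 l, l \in S & isolated S l \/ exists v, leaf S l v.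
Proof.
move=> /b_forest[l lS lu]; exists l => //.
have [/existsP[v /andP[vS blv]]|] := boolP [exists v, (v \in S) && b l v].
  by right; exists v; split=> // u uS blu; apply: lu.
by rewrite negb_exists => /forallP nb; left=> u uS; move: (nb u); rewrite uS.
Qed.

Lemma forest_gf S :
  has_gf (adm S) N #|S| ('X^(\sum_(u in S) w u) *+ m S).
Proof.
have [n] := ubnP #|S|; elim: n S => // n IH S /ltnSE Sn.
have [->|/forest_cases[l lS]] := eqVneq S finset.set0.
  rewrite big_set0 expr0 m0 cards0 (_ : adm _ = [set fun=> 0%N]).
    by apply: has_gf_set1; apply: indep_norm0.
  apply/seteqP; split=> a; last by move=> -> u; rewrite inE.
  by move=> /= Sa; apply/funext => u; move: (Sa u); rewrite inE.
have Sl : #|S| = #|(S :\ l)%SET|.+1 by rewrite (cardsD1 l) lS.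
have wS : (\sum_(u in S) w u = w l + \sum_(u in (S :\ l)%SET) w u)%N.
  by rewrite (big_setD1 l).
have gl := IH (S :\ l)%SET ltac:(lia).
case=> [iS|[v lf]].
  rewrite Sl wS exprD -mulrnAr (m_isolated lS iS).
  exact: adm_gf_isolated.
have [vS blv _] := lf.
have vSl : v \in (S :\ l)%SET.
  by rewrite !inE vS andbT; apply: contraTneq blv => ->; rewrite b_irr.
have Slv : #|(S :\ l)%SET| = #|(S :\ l :\ v)%SET|.+1 by rewrite (cardsD1 v) vSl.
have wSl : (\sum_(u in (S :\ l)%SET) w u = w v + \sum_(u in (S :\ l :\ v)%SET) w u)%N.
  by rewrite (big_setD1 v).
have glv := IH (S :\ l :\ v)%SET ltac:(lia).
rewrite Slv in gl; have := adm_gf_leaf lS lf gl glv.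
rewrite Sl Slv wS (m_leaf lS lf) mulrnDr; congr has_gf.
rewrite !mulrnAr exprD; congr (_ *+ _ + _ *+ _).
by rewrite -exprS wSl -exprD addnA (b_w blv).
Qed.

End ForestGeneratingFunction.

(** * Cuts of graphs without even cycles, and their matchings *)

Section Cuts.

Variables (T : finType) (e : rel T) (W : {set T}).

Definition cut : rel T := fun u v => e u v && ((u \in W) (+) (v \in W)).

Lemma cut_path x p : path cut x p ->
  (x \in W) (+) (last x p \in W) = odd (size p).
Proof.
elim: p x => [|y p IH] x /=; first by rewrite addbb.
by case/andP=> /andP[_ xy] /IH <-; move: xy; case: (x \in W); case: (y \in W) => //; case: (_ \in _).
Qed.

Lemma cut_cycle c : cycle cut c -> ~~ odd (size c).
Proof.
by case: c => [|x p] //= /cut_path; rewrite last_rcons addbb size_rcons /= => <-.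
Qed.

Hypothesis e_sym : symmetric e.
Hypothesis e_irr : irreflexive e.
Hypothesis e_noeven : no_even_cycle e.

Lemma cut_sym : symmetric cut.
Proof. by move=> u v; rewrite /cut e_sym addbC. Qed.

Lemma cut_irr : irreflexive cut.
Proof. by move=> u; rewrite /cut e_irr. Qed.

Lemma cut_acyclic c : ucycle cut c -> (size c <= 2)%N.
Proof.
move=> /andP[cc uc]; rewrite leqNgt; apply/negP => sc.
have := cut_cycle cc; rewrite e_noeven //; rewrite /ucycle uc andbT.
by apply: sub_cycle cc => u v /andP[].
Qed.

(* A path that cannot be extended at its head closes up into a cycle if its
   head has two neighbours. *)
Lemma cut_forest (S : {set T}) : S != finset.set0 ->
  exists2 l, l \in S & {in S &, forall u v, cut l u -> cut l v -> u = v}.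
Proof.
move=> /set0Pn[x0 x0S]; apply: contrapT => nleaf.
have two l y : l \in S -> exists u, [/\ u \in S, cut l u & u != y].
  move=> lS; apply: contrapT => nu; apply: nleaf; exists l => // u v uS vS lu lv.
  have uy z : z \in S -> cut l z -> z = y.
    by move=> zS lz; apply: contrapT => /eqP zy; apply: nu; exists z.
  by rewrite (uy u) // (uy v).
have long k : exists x y p, [/\ x \in S, path cut x (y :: p),
    uniq [:: x, y & p] & size p = k].
  elim: k => [|k [x [y [p [xS xyp uxyp sp]]]]].
    have [y [yS xy yx]] := two x0 x0 x0S; exists x0, y, [::].
    by rewrite x0S /= xy inE eq_sym yx.
  have [z [zS xz zy]] := two x y xS.
  have zx : z != x by apply: contraTneq xz => ->; rewrite cut_irr.
  (* If [z] lies on [p], then [x], [y] and the part of [p] up to [z] form a cut cycle with at least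
     three vertices. *)
  have [zp|zp] := boolP (z \in p).
    have := @cut_acyclic (x :: y :: rcons (take (index z p) p) z).
    move: xyp uxyp; rewrite -{1 2}(cat_take_drop (index z p) p) drop_index //.
    set p1 := take _ p; set p2 := drop _ p; rewrite -cat_rcons => xyp uxyp.
    have /andP[xy ypp] : cut x y && path cut y (rcons p1 z ++ p2) := xyp.
    suff cc : ucycle cut [:: x, y & rcons p1 z].
      by move=> /(_ cc); rewrite /= size_rcons.
    apply/andP; split.
      rewrite /= xy rcons_path /= last_rcons cut_sym xz andbT.
      by move: ypp; rewrite cat_path => /andP[].
    exact: (subseq_uniq (prefix_subseq [:: x, y & rcons p1 z] p2)).
  exists z, x, (y :: p); split=> //=; last by rewrite sp.
    by rewrite cut_sym xz.
  by rewrite !inE (negPf zx) (negPf zy) (negPf zp).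
have [x [y [p [_ _ uxyp sp]]]] := long #|T|.
have := max_card (mem [:: x, y & p]); rewrite (card_uniqP uxyp) /= sp.
by rewrite ltnNge leqnSn.
Qed.

End Cuts.

(** * The complex of pairwise disjoint oriented edges *)

Section Matchings.

Variables (T : finType) (e : rel T).

(** Edges are oriented because a cut edge has its negative end on either side, depending on [W]; the
    head will be the end in [W]. The two orientations of an edge are not disjoint. *)
Definition dart := {p : T * T | e p.1 p.2}.
Definition dtail (p : dart) := (val p).1.
Definition dhead (p : dart) := (val p).2.

Definition disjoint_darts (p q : dart) :=
  [&& dtail p != dtail q, dtail p != dhead q, dhead p != dtail q & dhead p != dhead q].

Definition matching_complex : {set {set dart}} :=
  [set A : {set dart} | [forall p in A, forall q in A,
    (p != q) ==> disjoint_darts p q]]%SET.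

Lemma in_matching_complex (A : {set dart}) :
  reflect {in A &, forall p q, p != q -> disjoint_darts p q}
          (A \in matching_complex).
Proof.
rewrite inE; apply: (iffP forall_inP) => H p.
  by move=> q pA qA; apply/implyP; exact: (forall_inP (H p pA)).
by move=> pA; apply/forall_inP => q qA; apply/implyP; exact: H.
Qed.

Lemma disjoint_dartsC p q : disjoint_darts p q = disjoint_darts q p.
Proof.
rewrite /disjoint_darts ![dtail q == _]eq_sym ![dhead q == _]eq_sym.
by do !case: (_ == _).
Qed.

Lemma simplicial_matching_complex : simplicial_complex matching_complex.
Proof.
split=> [|A B BD /fintype.subsetP AB]; apply/in_matching_complex => p.
  by rewrite inE.
by move=> q /AB pB /AB qB; apply: (in_matching_complex _ BD).
Qed.

(** Faces are defined by a condition on pairs: a non-face contains two darts that meet, and these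
    two already form a non-face. *)
Lemma flag_matching_complex : flag matching_complex.
Proof.
move=> A /minsetP[/= AD Amin].
have [p [q [pA qA pq npq]]] :
    exists p q, [/\ p \in A, q \in A, p != q & ~~ disjoint_darts p q].
  move: AD; rewrite inE => /forall_inPn[p pA /forall_inPn[q qA]].
  by rewrite negb_imply => /andP[pq npq]; exists p, q.
rewrite -(Amin [set p; q]%SET) ?cards2 ?pq //.
  by apply: contra npq => /in_matching_complex; apply; rewrite ?inE ?eqxx ?orbT.
by apply/fintype.subsetP => r /set2P[->|->].
Qed.

Section Oriented.

Variables (W : {set T}).
Implicit Types S : {set T}.

(** For symmetric [e], each cut edge inside [S] has exactly one such orientation, so [cut_matchings]
    amounts to the undirected matchings of the cut on [S]. *)
Definition good_dart (S : {set T}) (p : dart) :=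
  [&& dtail p \in S, dtail p \notin W, dhead p \in S & dhead p \in W].

Definition cut_matchings (S : {set T}) : {set {set dart}} :=
  [set A in matching_complex | [forall p in A, good_dart S p]]%SET.

Lemma in_cut_matchings S (A : {set dart}) :
  reflect (A \in matching_complex /\ {in A, forall p, good_dart S p})
          (A \in cut_matchings S).
Proof.
rewrite [X in reflect _ X]finset.in_set.
by apply: (iffP andP) => -[AD /forall_inP].
Qed.

Lemma cut_matchings0 : #|cut_matchings finset.set0| = 1%N.
Proof.
rewrite (_ : cut_matchings _ = [set finset.set0]%SET) ?cards1 //.
apply/finset.setP => A; rewrite finset.in_set1.
apply/in_cut_matchings/eqP => [[_ AS]|->].
  by apply/finset.setP => p; rewrite inE; apply/negP => /AS; rewrite /good_dart inE.
by split=> [|p]; [exact: (proj1 simplicial_matching_complex)|rewrite inE].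
Qed.

Hypothesis e_sym : symmetric e.
Hypothesis e_irr : irreflexive e.

Lemma good_dart_cut S p : good_dart S p -> cut e W (dtail p) (dhead p).
Proof. by case/and4P=> _ /negPf tW _ hW; rewrite /cut tW hW (valP p). Qed.

Lemma good_dartD1 S l p :
  good_dart (S :\ l) p = [&& good_dart S p, dtail p != l & dhead p != l].
Proof. by rewrite /good_dart !inE; do !case: (_ \in _); do ?case: (_ == _). Qed.

Lemma cut_matchings_isolated S l : l \in S -> isolated (cut e W) S l ->
  #|cut_matchings S| = #|cut_matchings (S :\ l)|.
Proof.
move=> lS iS; congr #|pred_of_set _|; apply/finset.setP => A.
apply/in_cut_matchings/in_cut_matchings => -[AD AS]; split=> // p pA; last first.
  by move: (AS p pA); rewrite good_dartD1 => /andP[].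
have pS := AS p pA; have := good_dart_cut pS; have /and4P[tS _ hS _] := pS.
rewrite good_dartD1 pS /= => c; apply/andP; split; apply: contraTneq c => ->.
  exact: iS.
by rewrite cut_sym //; exact: iS.
Qed.

Lemma cut_matchings_leaf S l v : l \in S -> leaf (cut e W) S l v ->
  #|cut_matchings S| = (#|cut_matchings (S :\ l)| + #|cut_matchings (S :\ l :\ v)|)%N.
Proof.
move=> lS [vS lv lu].
have vl : v != l by apply: contraTneq lv => ->; rewrite cut_irr.
(* [p0] is the leaf edge oriented into [W], the only good dart of [S] that meets [l]. *)
have [p0 [p0S p0lv p0l]] : exists p0 : dart, [/\ good_dart S p0,
    (forall u, (u == dtail p0) || (u == dhead p0) = (u == l) || (u == v)) &
    (forall p, good_dart S p -> (dtail p == l) || (dhead p == l) -> p = p0)].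
  have /andP[elv Wlv] := lv; have evl : e v l by rewrite e_sym.
  have [lW|lW] := boolP (l \in W).
    exists (exist _ (v, l) evl); split=> [|u|p pS].
    - by move: Wlv; rewrite /good_dart lS vS lW /= andbT; case: (_ \in _).
    - by rewrite orbC.
    move: (good_dart_cut pS) (pS) => c /and4P[tS tW hS hW].
    case/orP=> /eqP E; first by rewrite E lW in tW.
    apply: val_inj => /=; rewrite [val p]surjective_pairing -/(dtail p) -/(dhead p) E.
    by congr pair; apply: lu => //; rewrite cut_sym // -E.
  exists (exist _ (l, v) elv); split=> [|u|p pS] //.
  - by move: Wlv; rewrite /good_dart lS vS (negPf lW) /=; case: (_ \in _).
  move: (good_dart_cut pS) (pS) => c /and4P[tS tW hS hW].
  case/orP=> /eqP E; last by rewrite E (negPf lW) in hW.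
  apply: val_inj => /=; rewrite [val p]surjective_pairing -/(dtail p) -/(dhead p) E.
  by congr pair; apply: lu => //; rewrite -E.
have p0D p : disjoint_darts p p0 = [&& dtail p != l, dtail p != v, dhead p != l & dhead p != v].
  rewrite /disjoint_darts; move: (p0lv (dtail p)) (p0lv (dhead p)).
  by do !case: (_ == _).
have good2 p : good_dart (S :\ l :\ v) p = good_dart S p && disjoint_darts p p0.
  by rewrite !good_dartD1 p0D; do !case: (_ == _); rewrite ?andbF ?andbT.
have p0N p : good_dart (S :\ l :\ v) p -> p != p0.
  rewrite good2 => /andP[_]; apply: contraTneq => ->.
  by rewrite /disjoint_darts eqxx.
(* Matchings without [p0] avoid [l]; deleting [p0] from the others leaves the matchings of
   [S :\ l :\ v]. *)
rewrite -(cardsID [set A : {set dart} | p0 \in A]%SET) addnC; congr addn.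
  congr #|pred_of_set _|; apply/finset.setP => A; rewrite finset.in_setD inE.
  apply/andP/in_cut_matchings => [[p0A /in_cut_matchings[AD AS]]|[AD AS]].
    split=> // p pA; rewrite good_dartD1 AS //= -negb_or; apply: contra p0A => pl.
    by rewrite -(p0l p) // AS.
  split; last first.
    by apply/in_cut_matchings; split=> // p /AS; rewrite good_dartD1 => /andP[].
  apply/negP => /AS; rewrite good_dartD1 => /and3P[_ t h].
  by move: (p0lv l); rewrite eqxx /= ![l == _]eq_sym (negPf t) (negPf h).
rewrite -(@card_in_imset _ _ (fun A => p0 |: A)%SET
  (mem (cut_matchings (S :\ l :\ v)))); last first.
  move=> A B /in_cut_matchings[_ AS] /in_cut_matchings[_ BS] AB.
  have p0AN (C : {set dart}) : {in C, forall p, good_dart (S :\ l :\ v) p} -> p0 \notin C.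
    by move=> CS; apply/negP => /CS /p0N; rewrite eqxx.
  by rewrite -(setU1K (p0AN _ AS)) AB setU1K // p0AN.
congr #|pred_of_set _|; apply/finset.setP => A.
rewrite finset.in_setI inE; apply/andP/imsetP => [[AM p0A]|[B BM ->]].
  exists (A :\ p0)%SET; last by rewrite finset.setD1K.
  have /in_cut_matchings[AD AS] := AM.
  apply/in_cut_matchings; split.
    by apply: (proj2 simplicial_matching_complex _ A) => //; rewrite subD1set.
  move=> p; rewrite !inE => /andP[pp0 pA]; rewrite good2 AS //=.
  exact: (in_matching_complex _ AD).
have /in_cut_matchings[BD BS] := BM.
have BS' p : p \in B -> disjoint_darts p p0 by move/BS; rewrite good2 => /andP[].
split; last by rewrite setU11.
apply/in_cut_matchings; split; last first.
  by move=> p /setU1P[->|/BS] //; rewrite good2 => /andP[].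
apply/in_matching_complex => p q /setU1P[->|pB] /setU1P[->|qB].
- by rewrite eqxx.
- by rewrite disjoint_dartsC BS'.
- by rewrite BS'.
exact: (in_matching_complex _ BD).
Qed.

End Oriented.

End Matchings.

(** * From levels of a norm to balls *)

Definition ball (U : choiceType) (A : set U) (N : U -> nat) (k : nat) : set U :=
  [set a | A a /\ (N a <= k)%N].

(** The second component of [A'] is the slack between norm and radius, so levels of [A'] project
    bijectively onto balls of [A]. The slack costs one more factor [1 - X], which accounts for the
    exponent dimension plus one in the Ehrhart series. *)
Lemma ball_gf (U : choiceType) (A : set U) N d p : has_gf A N d p ->
  (forall k, finite_set (ball A N k)) /\
  forall k, p`_k = \sum_(j < k.+1) ((1 - 'X) ^+ d.+1)`_j *
             #|` fset_set (ball A N (k - j))|%fset%:Z.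
Proof.
move=> gA.
pose A' := [set u : U * nat | A u.1]; pose N' (u : U * nat) := (N u.1 + u.2)%N.
have [fA' gA'] : has_gf A' N' d.+1 p.
  apply: (@has_gf_step _ (fun u => (u.1, u.2.+1)) _ ((fun a => (a, 0%N)) @` A)).
  - by move=> [a j] [a' j'] _ _ [-> ->].
  - by move=> [a j] _; rewrite /N' addnS.
  - apply/seteqP; split=> -[a j]; rewrite /A' /=.
      by case: j => [|j] Aa; [left; exists a|right; exists (a, j)].
    by case=> [[a' Aa' [<- _]]|[[a' j'] /= Aa' [<- _]]].
  - by move=> [a j] /= [[a' _ [_ <-]] [[a'' j''] _ []]].
  - rewrite -[p]mul1r -(expr0 'X); apply: has_gf_image gA; last first.
      by move=> a _; rewrite /N' /= addn0.
    by move=> a a' _ _ [].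
have ballE k : ball A N k = fst @` level A' N' k.
  apply/seteqP; split=> a /=.
    by move=> [Aa Nk]; exists (a, k - N a)%N => //; split; rewrite /A' /N' //= subnKC.
  by case=> -[a' j] [Aa' /= <-] <-; split=> //; exact: leq_addr.
have cardE k : card_level A' N' k = #|` fset_set (ball A N k)|%fset.
  rewrite ballE card_fset_set_image // => -[a j] [a' j'] [_ /= ak] [_ /= ak'] E.
  move: ak ak'; rewrite /N' /= E => <- /eqP; rewrite eqn_add2l => /eqP.
  by move=> ->.
split=> k; first by rewrite ballE; apply: finite_image.
rewrite -(gA' k.+1) // coefM; apply: eq_bigr => j _; congr (_ * _).
by rewrite coef_poly ltnS leq_subr cardE.
Qed.

(** * Summation over sign patterns *)

Section GammaSum.

Variables (T : finType) (e : rel T).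
Hypothesis e_sym : symmetric e.
Hypothesis e_irr : irreflexive e.

Lemma matching_ends (A : {set dart e}) : A \in matching_complex e ->
  [/\ #|@dtail T e @: A| = #|A|, #|@dhead T e @: A| = #|A|
    & {in @dtail T e @: A, forall u, u \notin @dhead T e @: A}].
Proof.
move=> /in_matching_complex AD; split.
- rewrite card_in_imset // => p q pA qA E; apply: contraTeq isT => pq.
  by move: (AD p q pA qA pq); rewrite /disjoint_darts E eqxx.
- rewrite card_in_imset // => p q pA qA E; apply: contraTeq isT => pq.
  by move: (AD p q pA qA pq); rewrite /disjoint_darts E eqxx !andbF.
move=> _ /imsetP[p pA ->]; apply/negP => /imsetP[q qA E].
have [pq|pq] := eqVneq p q.
  have epp : e (dtail p) (dhead p) := valP p.
  by rewrite E pq e_irr in epp.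
by move: (AD p q pA qA pq); rewrite /disjoint_darts E eqxx !andbF.
Qed.

Lemma card_disjointU (H L : {set T}) : {in H, forall u, u \notin L} ->
  #|(H :|: L)%SET| = (#|H| + #|L|)%N.
Proof.
move=> HL; rewrite cardsU (_ : (H :&: L)%SET = finset.set0) ?cards0 ?subn0 //.
by apply/finset.setP => u; rewrite !inE; apply/negP => /andP[/HL/negP].
Qed.

Lemma matching_card (A : {set dart e}) : A \in matching_complex e ->
  (#|A|.*2 <= #|T|)%N.
Proof.
move=> /matching_ends[tA hA /card_disjointU]; rewrite tA hA addnn => <-.
exact: max_card.
Qed.

Lemma sum_separating_sets (H L : {set T}) : {in H, forall u, u \notin L} ->
  \sum_(W : {set T} | (H \subset W) && (L \subset ~: W)%SET) 'X^#|W| =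
  'X^#|H| * (1 + 'X) ^+ (#|T| - (#|H| + #|L|)) :> {poly int}.
Proof.
move=> HL.
(* In the expanded product, [F] is taken on [W] and [G] off [W]: the zeros of [F] kill each [W]
   meeting [L], those of [G] each [W] not containing [H]. *)
pose F u : {poly int} := if u \in L then 0 else 'X.
pose G u : {poly int} := if u \in H then 0 else 1.
transitivity (\prod_u (F u + G u)).
  rewrite bigA_distr big_mkcond; apply: eq_bigr => W _.
  case: ifP => [/andP[/fintype.subsetP HW /fintype.subsetP LW]|].
    rewrite -prodr_const [LHS]big_mkcond; apply: eq_bigr => u _; rewrite /F /G.
    case: ifP => uW; first by case: ifP => // /LW; rewrite inE uW.
    by case: ifP => // /HW; rewrite uW.
  move/negbT; rewrite negb_and => /orP[] /subsetPn[u uH].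
    by move=> uW; rewrite (bigD1 u) //= (negPf uW) /G uH mul0r.
  by rewrite inE negbK => uW; rewrite (bigD1 u) //= uW /F uH mul0r.
transitivity (\prod_u ((if u \in H then 'X else 1) *
    (if u \in (~: (H :|: L))%SET then 1 + 'X else 1)) : {poly int}).
  apply: eq_bigr => u _; rewrite !inE /F /G; have [uH|uH] := boolP (u \in H).
    by rewrite (negPf (HL u uH)) /= addr0 mulr1.
  by case: (u \in L); rewrite /= ?add0r ?mul1r // addrC.
rewrite big_split -!big_mkcond !prodr_const; congr (_ * _ ^+ _).
by rewrite -card_disjointU // cardsCs finset.setCK.
Qed.

Lemma sum_cut_matchings :
  \sum_(W : {set T}) 'X^#|W| *+ #|@cut_matchings T e W finset.setT| =
  \sum_(A in matching_complex e) 'X^#|A| * (1 + 'X) ^+ (#|T| - #|A|.*2)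
    :> {poly int}.
Proof.
under eq_bigr => W _ do rewrite -sumr_const.
rewrite (exchange_big_dep (mem (matching_complex e))) /=; last first.
  by move=> W A _ /in_cut_matchings[].
apply: eq_bigr => A AD; have [tA hA tAhA] := matching_ends AD.
rewrite -addnn -{1 2}hA -tA -sum_separating_sets; last first.
  by move=> u uh; apply/negP => /tAhA; rewrite uh.
apply: eq_bigl => W; apply/in_cut_matchings/andP => [[_ AW]|[hW tW]].
  split; apply/fintype.subsetP => _ /imsetP[p /AW /and4P[_ tW _ hW] ->] //.
  by rewrite inE.
split=> // p pA; rewrite /good_dart !finset.in_setT /=.
apply/andP; split; last by apply: (fintype.subsetP hW); rewrite imset_f.
by move/fintype.subsetP: tW => /(_ (dtail p)); rewrite inE; apply; rewrite imset_f.
Qed.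

Hypothesis e_noeven : no_even_cycle e.

Definition sgn_indicator (W : {set T}) (u : T) : nat := (u \in W).

(* [W] is the set of negative coordinates and [a] is the absolute value of an
   integer vector. *)
Definition signed_vectors : set ({set T} * (T -> nat)) :=
  [set u | adm (sgn_indicator u.1) finset.setT u.2].

Definition signed_norm (u : {set T} * (T -> nat)) : nat :=
  indep_norm (cut e u.1) u.2.

Lemma signed_gf : has_gf signed_vectors signed_norm #|T|
  (\sum_(A in matching_complex e) 'X^#|A| * (1 + 'X) ^+ (#|T| - #|A|.*2)).
Proof.
rewrite -sum_cut_matchings; apply: (@has_gf_sigma _ _ (fun W => adm (sgn_indicator W) finset.setT)
  (fun W => indep_norm (cut e W))) => W.
have -> : #|W| = (\sum_(u in finset.setT) sgn_indicator W u)%N.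
  rewrite -sum1_card [LHS]big_mkcond; rewrite [RHS]big_mkcond.
  apply: eq_bigr => u _; rewrite finset.in_setT.
  by rewrite /sgn_indicator; case: (u \in W).
rewrite -cardsT.
apply: (@forest_gf T (cut e W) _ (fun S => #|cut_matchings e W S|)).
- exact: cut_sym.
- exact: cut_irr.
- move=> u v /andP[_]; rewrite /sgn_indicator.
  by case: (u \in W); case: (v \in W).
- exact: cut_forest.
- exact: cut_matchings0.
- by move=> S l; apply: cut_matchings_isolated.
- by move=> S l v; apply: cut_matchings_leaf.
Qed.

End GammaSum.

(** * Lattice points of the suspension polytope *)

Section ConvexHulls.

Variables (R : realType) (N : nat).
Implicit Types A : set 'rV[R]_N.

Lemma convex_setP A : @convex_set R 'rV[R]_N A <->
  forall x y (t : R), 0 <= t -> t <= 1 -> A x -> A y ->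
    A (t *: x + (1 - t) *: y).
Proof.
split=> [cA x y t t0 t1 Ax Ay|cA x y t].
  by have := cA x y (Itv01 t0 t1); rewrite !inE; apply.
rewrite !inE => Ax Ay; rewrite /conv /=; apply: cA => //.
Qed.

Lemma convex_hull_conv A x y (t : R) : 0 <= t -> t <= 1 ->
  convex_hull A x -> convex_hull A y -> convex_hull A (t *: x + (1 - t) *: y).
Proof.
move=> t0 t1 Ax Ay B [/= cB AB].
by move/convex_setP: (cB); apply => //; [apply: Ax|apply: Ay].
Qed.

End ConvexHulls.

Section SuspensionPolytope.

Variables (R : realType) (n : nat) (e : rel 'I_n).
Hypothesis e_sym : symmetric e.
Hypothesis e_irr : irreflexive e.

Let P : set 'rV[R]_n.+1 := sym_edge_polytope R (suspension e).

Definition apex_vec (A : pzRingType) (v : 'I_n) : 'rV[A]_n.+1 :=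
  delta_mx 0 (lift ord_max v) - delta_mx 0 ord_max.

(** The dropped apex coordinate is restored as minus the sum of the others. The ring stays open
    because lattice points live over [int] and the polytope over [R]. *)
Definition signed_vec (A : pzRingType) (W : {set 'I_n}) (a : 'I_n -> nat) :
    'rV[A]_n.+1 :=
  \sum_v ((-1) ^+ (v \in W) * (a v)%:R) *: apex_vec A v.

Lemma suspension_lift u v :
  suspension e (lift ord_max u) (lift ord_max v) = e u v.
Proof. by rewrite /suspension !liftK. Qed.

Lemma suspension_apex v : suspension e (lift ord_max v) ord_max.
Proof. by rewrite /suspension liftK unlift_none. Qed.

Lemma apex_vec_lift A v u :
  apex_vec A v 0 (lift ord_max u) = (u == v)%:R.
Proof.
rewrite !mxE !eqxx /= (inj_eq lift_inj) [lift _ _ == ord_max]eq_sym.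
by rewrite (negPf (neq_lift _ _)) subr0.
Qed.

Lemma sum_apex_vec A v : \sum_i apex_vec A v 0 i = 0.
Proof.
under eq_bigr do rewrite !mxE !eqxx /=.
rewrite sumrB (bigD1 (lift ord_max v)) //= eqxx big1 => [|i /negPf-> //].
by rewrite (bigD1 ord_max) //= eqxx big1 => [|i /negPf-> //]; rewrite subrr.
Qed.

Lemma signed_vec_lift A W a u :
  signed_vec A W a 0 (lift ord_max u) = (-1) ^+ (u \in W) * (a u)%:R.
Proof.
rewrite summxE (bigD1 u) //= big1 => [|v vu]; rewrite mxE apex_vec_lift.
  by rewrite eqxx mulr1 addr0.
by rewrite eq_sym (negPf vu) mulr0.
Qed.

Lemma sum_signed_vec A W a : \sum_i signed_vec A W a 0 i = 0.
Proof.
under eq_bigr do rewrite summxE.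
rewrite exchange_big big1 // => v _; under eq_bigr do rewrite mxE.
by rewrite -mulr_sumr sum_apex_vec mulr0.
Qed.

Lemma row_ext (A : zmodType) (x y : 'rV[A]_n.+1) :
    (forall v, x 0 (lift ord_max v) = y 0 (lift ord_max v)) ->
    \sum_i x 0 i = \sum_i y 0 i -> x = y.
Proof.
move=> xy; rewrite !(bigD1_ord ord_max) //= (eq_bigr _ (fun v _ => xy v)).
move=> /addIr xy0; apply/rowP => i.
by case: (unliftP ord_max i) => [v ->|->].
Qed.

Lemma edge_in_polytope i j : suspension e i j ->
  P (delta_mx 0 i - delta_mx 0 j) /\ P (- (delta_mx 0 i - delta_mx 0 j)).
Proof.
by move=> ij; split; apply: sub_gen_smallest; exists i, j; split=> //; [left|right].
Qed.

Definition dilate (t : nat) : set 'rV[R]_n.+1 := [set t%:R *: x | x in P].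

(** By convexity, with weights [s / (s + t)] and [t / (s + t)]; if [s + t = 0], both points are the
    origin. *)
Lemma dilateD s t x y : dilate s x -> dilate t y -> dilate (s + t) (x + y).
Proof.
move=> [x' Px <-] [y' Py <-]; have [st0|st] := posnP (s + t)%N.
  move: st0 => /eqP; rewrite addn_eq0 => /andP[/eqP-> /eqP->].
  by exists x' => //; rewrite !scale0r addr0.
have st' : (s + t)%:R != 0 :> R by rewrite pnatr_eq0 -lt0n.
have [s0 t0] : 0 <= s%:R :> R /\ 0 <= t%:R :> R by rewrite !ler0n.
exists ((s%:R / (s + t)%:R) *: x' + (1 - s%:R / (s + t)%:R) *: y').
  apply: (convex_hull_conv _ _ Px Py); first by rewrite divr_ge0 ?ler0n.
  by rewrite ler_pdivrMr ?ltr0n // mul1r ler_nat leq_addr.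
rewrite scalerDr !scalerA mulrBr mulr1 mulrCA divff // mulr1; congr (_ + _ *: _).
by rewrite natrD addrC addKr.
Qed.

Lemma dilate_scale t x : P x -> dilate t (t%:R *: x).
Proof. by exists x. Qed.

Lemma dilate_sign t (s : bool) i j : suspension e i j ->
  dilate t (((-1) ^+ s * t%:R) *: (delta_mx 0 i - delta_mx 0 j)).
Proof.
move=> /edge_in_polytope[Pij nPij]; rewrite mulrC -scalerA; apply: dilate_scale.
by case: s; rewrite ?expr1 ?expr0 ?scaleN1r ?scale1r.
Qed.

(** The origin is the midpoint of an edge vector and its opposite. For [n = 0] the suspension has no
    edge and the polytope is empty. *)
Lemma zero_in_polytope : (0 < n)%N -> P 0.
Proof.
move=> n0; have [Px nPx] := edge_in_polytope (suspension_apex (Ordinal n0)).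
have := @convex_hull_conv R _ _ _ _ 2^-1 _ _ Px nPx.
set x := _ - _; rewrite (_ : 2^-1 *: x + _ *: - x = 0); last first.
  by rewrite scalerN -scalerBl (_ : 2^-1 - _ = 0 :> R) ?scale0r //; lra.
by apply; lra.
Qed.

Lemma dilate_le s t x : (0 < n)%N -> (s <= t)%N -> dilate s x -> dilate t x.
Proof.
move=> n0 st Px; rewrite -(subnKC st) -[x]addr0; apply: dilateD => //.
by exists 0; [exact: zero_in_polytope|rewrite scaler0].
Qed.

Lemma signed_vec_upd A W a l : signed_vec A W a =
  ((-1) ^+ (l \in W) * (a l)%:R) *: apex_vec A l + signed_vec A W (upd a l 0%N).
Proof.
apply: row_ext => [v|].
  rewrite mxE !signed_vec_lift mxE apex_vec_lift /upd.
  by case: (eqVneq v l) => [->|_]; rewrite !(mulr1, mulr0, addr0, add0r).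
rewrite sum_signed_vec; under [RHS]eq_bigr do rewrite mxE [_ 0 _ in X in X + _]mxE.
by rewrite big_split /= -mulr_sumr sum_apex_vec sum_signed_vec mulr0 addr0.
Qed.

Hypothesis e_noeven : no_even_cycle e.

(** The attained half of the duality: the leaf recursion of the norm is matched step by step by
    splitting off multiples of edge vectors. *)
Lemma signed_vec_dilate W a : (0 < n)%N ->
  dilate (indep_norm (cut e W) a) (signed_vec R W a).
Proof.
move=> n0; have b_sym := cut_sym W e_sym; have b_irr := cut_irr W e_irr.
(* The weights vanish outside [S], so an isolated vertex or a leaf relative to [S] meets the
   hypotheses of the norm recursion. *)
suff dil k (S : {set 'I_n}) c : (forall u, u \notin S -> c u = 0%N) ->
    (#|S| < k)%N -> dilate (indep_norm (cut e W) c) (signed_vec R W c).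
  by apply: (dil _ finset.setT) (ltnSn _) => u; rewrite inE.
elim: k S c => {a} // k IH S a aS /ltnSE Sk.
have [S0|S0] := eqVneq S finset.set0.
  exists 0; first exact: zero_in_polytope.
  rewrite scaler0 /signed_vec big1 // => v _.
  by rewrite aS ?S0 ?inE // mulr0 scale0r.
have [l lS lcase] := forest_cases (@cut_forest _ e W e_sym e_irr e_noeven) S0.
have Sl : #|(S :\ l)%SET| = #|S|.-1 by rewrite [in RHS](cardsD1 l) lS.
have Sk' : (#|(S :\ l)%SET| < k)%N by rewrite Sl; move: S0 Sk; rewrite -card_gt0; lia.
case: lcase => [iS|[v [vS lv lu]]].
  rewrite (signed_vec_upd _ _ _ l) (@indep_norm_isolated _ _ b_sym b_irr _ l).
    apply: dilateD; first by apply: dilate_sign; exact: suspension_apex.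
    apply: IH Sk' => u; rewrite !inE /upd negb_and negbK.
    by case: eqP => //= _; apply: aS.
  move=> u lu; apply: aS; apply: contraL lu; exact: iS.
have vl : v != l by apply: contraTneq lv => ->; rewrite b_irr.
rewrite (@indep_norm_leaf _ _ b_sym b_irr _ l v) //; last first.
  move=> u blu uv; apply: aS; apply: contraNN uv => uS; apply/eqP; exact: lu.
(* The ends of a cut edge have opposite signs, so [m] copies of the edge vector reduce both absolute
   values at once. What is left at [l] goes along the edge to the apex; the total used is
   [m + (a l - a v) = a l]. *)
set a' := upd _ l 0%N; set m := minn (a l) (a v).
have sv : (-1) ^+ (v \in W) = - (-1) ^+ (l \in W) :> R.
  by case/andP: lv => _; case: (l \in W); case: (v \in W); rewrite ?expr0 ?expr1 ?opprK.
have -> : signed_vec R W a =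
    (((-1) ^+ (l \in W) * m%:R) *: (delta_mx 0 (lift ord_max l) - delta_mx 0 (lift ord_max v))
    + ((-1) ^+ (l \in W) * (a l - a v)%:R) *: apex_vec R l) + signed_vec R W a'.
  rewrite (signed_vec_upd _ _ _ l) (signed_vec_upd _ _ (upd a l 0%N) v).
  rewrite (signed_vec_upd _ _ a' v).
  have -> : upd a' v 0 = upd (upd a l 0) v 0.
    by apply/funext => u; rewrite /a' /upd; do !case: eqP.
  have -> : upd a l 0%N v = a v by rewrite /upd (negPf vl).
  have -> : a' v = (a v - a l)%N by rewrite /a' /upd (negPf vl) eqxx.
  have -> : (a l)%:R = m%:R + (a l - a v)%:R :> R by rewrite -natrD; congr _%:R; lia.
  have -> : (a v)%:R = m%:R + (a v - a l)%:R :> R by rewrite -natrD; congr _%:R; lia.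
  by rewrite sv; apply/rowP => i; rewrite !mxE; ring.
rewrite (_ : a l + _ = m + (a l - a v) + indep_norm (cut e W) a')%N; last by lia.
apply: dilateD; first apply: dilateD.
- by apply: dilate_sign; rewrite suspension_lift; case/andP: lv.
- by apply: dilate_sign; exact: suspension_apex.
apply: IH Sk' => u; rewrite !inE /a' /upd negb_and negbK.
case: eqP => //= _ /aS au; case: eqP => // uv.
by rewrite -uv au.
Qed.

Definition cut_form (I W : {set 'I_n}) (x : 'rV[R]_n.+1) : R :=
  \sum_(v in I) (-1) ^+ (v \in W) * x 0 (lift ord_max v).

(** An edge with both ends in [I] is not cut, so its two signs agree and cancel; any other edge
    meets [I] at most once. Thus the form is in {-1, 0, 1} on the generators, and convexity does the
    rest. *)
Lemma cut_form_le1 I W x : indep (cut e W) I -> P x -> cut_form I W x <= 1.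
Proof.
move=> /indepP iI.
have fD y z : cut_form I W (y + z) = cut_form I W y + cut_form I W z.
  by rewrite -big_split; apply: eq_bigr => v _; rewrite mxE mulrDr.
have fZ (t : R) y : cut_form I W (t *: y) = t * cut_form I W y.
  by rewrite mulr_sumr; apply: eq_bigr => v _; rewrite mxE mulrCA.
have fN y : cut_form I W (- y) = - cut_form I W y by rewrite -scaleN1r fZ mulN1r.
have fmax : cut_form I W (delta_mx 0 ord_max) = 0.
  apply: big1 => v _; rewrite mxE eq_sym (negPf (neq_lift _ _)) andbF mulr0.
  by [].
have flift u : cut_form I W (delta_mx 0 (lift ord_max u)) =
    if u \in I then (-1) ^+ (u \in W) else 0.
  have [uI|uI] := boolP (u \in I).
    rewrite /cut_form (bigD1 u) //= mxE !eqxx mulr1 big1 ?addr0 // => v /andP[_ vu].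
    by rewrite mxE (inj_eq lift_inj) (negPf vu) andbF mulr0.
  apply: big1 => v vI; rewrite mxE (inj_eq lift_inj).
  by rewrite (_ : v == u = false) ?andbF ?mulr0 //; apply: contraNF uI => /eqP <-.
have s1 (s : bool) : `|(-1) ^+ s| <= 1 :> R by rewrite normrX normrN1 expr1n.
have fedge i j : suspension e i j ->
    `|cut_form I W (delta_mx 0 i - delta_mx 0 j)| <= 1.
  rewrite fD fN; case: (unliftP ord_max i) => [u ->|->];
    case: (unliftP ord_max j) => [v ->|->]; rewrite ?fmax ?flift ?subr0 ?sub0r ?normrN.
  - rewrite suspension_lift => euv.
    have [uI|uI] := boolP (u \in I); have [vI|vI] := boolP (v \in I);
      rewrite ?subr0 ?sub0r ?normrN ?normr0 ?ler01 //.
    have := iI u v uI vI; rewrite /cut euv /= addbC.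
    by case: (u \in W); case: (v \in W) => //; rewrite subrr normr0 ler01.
  - by case: ifP; rewrite ?normr0 ?ler01.
  - by case: ifP; rewrite ?normr0 ?ler01.
  - by rewrite normr0 ler01.
move: x; apply: smallest_sub.
  apply/convex_setP => x y t t0 t1 /= x1 y1; rewrite fD !fZ.
  have := mulr_ge0 t0 (_ : 0 <= 1 - cut_form I W x).
  have := mulr_ge0 (_ : 0 <= 1 - t) (_ : 0 <= 1 - cut_form I W y).
  by rewrite !subr_ge0 => /(_ t1 y1) + /(_ x1); lra.
move=> _ [i [j [/fedge + [->|->]]]] /=; first by move/ler_normlP => [].
by rewrite fN -normrN => /ler_normlP[].
Qed.

Lemma polytope_sum0 x : P x -> \sum_i x 0 i = 0.
Proof.
move: x; apply: smallest_sub.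
  apply/convex_setP => x y t t0 t1 /= x1 y1; under eq_bigr do rewrite !mxE.
  by rewrite big_split /= -!mulr_sumr x1 y1 !mulr0 addr0.
have dsum (i : 'I_n.+1) : \sum_j (delta_mx 0 i : 'rV[R]_n.+1) 0 j = 1.
  rewrite (bigD1 i) //= mxE !eqxx big1 ?addr0 // => j ji.
  by rewrite mxE (negPf ji) andbF.
move=> _ [i [j [_ [->|->]]]] /=; last under eq_bigr do rewrite mxE.
  by under eq_bigr do rewrite mxE [_ _ _ in X in _ + X]mxE; rewrite sumrB !dsum subrr.
under eq_bigr do rewrite mxE [_ _ _ in X in _ + X]mxE.
by rewrite sumrN sumrB !dsum subrr oppr0.
Qed.

Lemma dilate_lattice_pointsE t : (0 < n)%N ->
  dilate_lattice_points P t =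
  (fun u => signed_vec int u.1 u.2) @` ball (@signed_vectors _) (signed_norm e) t.
Proof.
move=> n0; have map_vec W a : map_mx intr (signed_vec int W a) = signed_vec R W a.
  apply: row_ext => [v|].
    rewrite mxE !signed_vec_lift rmorphM rmorphXn rmorphN1 /=.
    by rewrite -[(a v)%:R]/((a v)%:R : int) rmorph_nat.
  under eq_bigr do rewrite mxE.
  by rewrite -rmorph_sum !sum_signed_vec.
apply/seteqP; split=> z; last first.
  move=> [[W a] [_ /= Nt] <-]; rewrite /dilate_lattice_points /= map_vec.
  exact: dilate_le Nt (signed_vec_dilate _ _ n0).
move=> [y Py yz].
(* The strict inequality puts zero coordinates outside [W], as [signed_vectors] demands. *)
pose W := [set v | z 0 (lift ord_max v) < 0]%SET.
pose a v := absz (z 0 (lift ord_max v)).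
have za v : z 0 (lift ord_max v) = (-1) ^+ (v \in W) * (a v)%:R.
  rewrite inE /a; case: (z 0 _) => k /=; first by rewrite mul1r natz.
  by rewrite NegzE mulN1r natz.
have zy i : (z 0 i)%:~R = t%:R * y 0 i.
  by move/rowP: yz => /(_ i); rewrite !mxE.
exists (W, a); last first.
  apply: row_ext => [v|]; first by rewrite signed_vec_lift za.
  rewrite sum_signed_vec; apply/eqP; rewrite eq_sym -(eqr_int R) rmorph_sum /=.
  under eq_bigr do rewrite zy.
  by rewrite -mulr_sumr polytope_sum0 // mulr0.
split.
  move=> v; rewrite inE /sgn_indicator /=; have := za v; rewrite inE /a.
  by case: (z 0 _) => -[|k].
apply: indep_norm_le => I iI /=.
rewrite -(ler_nat R) natr_sum.
(* The signs in the form are those of [z] itself, so its terms become absolute values. *)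
have -> : \sum_(v in I) (a v)%:R = t%:R * cut_form I W y.
  rewrite mulr_sumr; apply: eq_bigr => v _; rewrite mulrCA -zy za.
  by rewrite rmorphM rmorphXn rmorphN1 /= mulrA -exprD addnn -mul2n
    exprM sqrrN expr1n expr1n mul1r natz.
by rewrite ler_piMr ?ler0n // cut_form_le1.
Qed.

(** The sign can be recovered because [a v] is positive on [W]. *)
Lemma signed_vec_inj u u' : signed_vectors u -> signed_vectors u' ->
  signed_vec int u.1 u.2 = signed_vec int u'.1 u'.2 -> u = u'.
Proof.
case: u u' => [W a] [W' a'] /= Wa Wa' E.
have {}E v : (v \in W) = (v \in W') /\ a v = a' v.
  have := congr1 (fun z : 'rV_n.+1 => z 0 (lift ord_max v)) E.
  have := Wa v; have := Wa' v; rewrite !signed_vec_lift !inE /sgn_indicator /=.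
  by case: (v \in W); case: (v \in W'); rewrite ?expr0 ?expr1 ?mul1r ?mulN1r ?natz; split=> //; lia.
have -> : W = W' by apply/finset.setP => v; case: (E v).
by congr pair; apply/funext => v; case: (E v).
Qed.

Lemma dim_succ_polytope : (0 < n)%N -> dim_succ P = n.+1.
Proof.
move=> n0; apply/eqP; rewrite eqn_leq; apply/andP; split.
  apply/bigmax_leqP => k /asboolP[X [PX indX]]; rewrite leqNgt; apply/negP => kn.
  (* The column of ones encodes the vanishing of the coefficient sum. It may replace the apex
     column, since coordinate sums vanish on [P]. *)
  pose M := \matrix_(i < k, j < n.+1) (if j == ord_max then 1 else X i 0 j).
  have : kermx M != 0.
    by rewrite kermx_eq0 /row_free neq_ltn (leq_ltn_trans (rank_leq_col M) kn).
  move=> /rowV0Pn[c /sub_kermxP cM /negP]; apply; apply/eqP/rowP => i.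
  rewrite mxE; apply: (indX (fun i => c 0 i)).
    have := congr1 (fun z : 'rV_n.+1 => z 0 ord_max) cM.
    by rewrite !mxE => cMv; rewrite -[RHS]cMv; apply: eq_bigr => j _; rewrite !mxE eqxx mulr1.
  apply: row_ext => [v|].
    have := congr1 (fun z : 'rV_n.+1 => z 0 (lift ord_max v)) cM.
    rewrite !mxE => cMv; rewrite -[RHS]cMv summxE; apply: eq_bigr => j _.
    by rewrite !mxE eq_sym (negPf (neq_lift _ _)).
  under eq_bigr do rewrite summxE.
  rewrite exchange_big /= big1 => [|j _]; first by rewrite big1 // => ? _; rewrite mxE.
  by under eq_bigr do rewrite mxE; rewrite -mulr_sumr polytope_sum0 // mulr0.
have nk : (n.+1 < n.+1.+2)%N by rewrite ltnW.
rewrite -[n.+1]/(val (Ordinal nk)); apply: leq_bigmax_cond; apply/asboolP => /=.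
(* Off the apex these vectors form the standard basis, so together with the origin they are affinely
   independent. *)
exists (fun i => if unlift ord_max i is Some v then apex_vec R v else 0); split.
  move=> i; case: (unlift _ i) => [v|]; last exact: zero_in_polytope.
  by have [] := edge_in_polytope (suspension_apex v).
move=> c c0 cX; have cl v : c (lift ord_max v) = 0.
  have := congr1 (fun z : 'rV_n.+1 => z 0 (lift ord_max v)) cX.
  rewrite summxE mxE (bigD1_ord ord_max) //= unlift_none scaler0 mxE add0r.
  rewrite (bigD1 v) //= liftK mxE apex_vec_lift eqxx mulr1 big1 ?addr0 // => u uv.
  by rewrite liftK mxE apex_vec_lift eq_sym (negPf uv) mulr0.
move=> i; case: (unliftP ord_max i) => [v ->|->] //.
by move: c0; rewrite (bigD1_ord ord_max) //= big1 ?addr0.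
Qed.

End SuspensionPolytope.

(** * The Ehrhart numerator and its gamma expansion *)

Section MainTheorem.

Variables (R : realType) (n : nat) (e : rel 'I_n).
Hypothesis e_sym : symmetric e.
Hypothesis e_irr : irreflexive e.
Hypothesis e_noeven : no_even_cycle e.

Let P : set 'rV[R]_n.+1 := sym_edge_polytope R (suspension e).

Let D := matching_complex e.

Let h : {poly int} := \sum_(A in D) 'X^#|A| * (1 + 'X) ^+ (n - #|A|.*2).

Lemma matching_polynomial_gamma : is_gamma n h (f_poly D).
Proof.
have An A : A \in D -> (#|A| < n./2.+1)%N.
  move=> /(matching_card e_irr); rewrite card_ord ltnS => A2.
  by rewrite -[#|A|]doubleK half_leq.
split.
  apply: (big_ind (fun p : {poly int} => size p <= n./2.+1)%N).
  - by rewrite size_poly0.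
  - by move=> p q sp sq; rewrite (leq_trans (size_polyD _ _)) // geq_max sp.
  - by move=> A /An; rewrite size_polyXn.
transitivity (\sum_(A in D) \sum_(i < n./2.+1)
    ('X^#|A| : {poly int})`_i *: ('X^i * (1 + 'X) ^+ (n - i.*2)) : {poly int}).
  apply: eq_bigr => A /An An2; rewrite (bigD1 (Ordinal An2)) //= coefXn eqxx scale1r.
  rewrite big1 ?addr0 // => i iA; rewrite coefXn (_ : (_ == _) = false) ?scale0r //.
  by apply: contraNF iA => /eqP iA; apply/eqP/val_inj.
rewrite exchange_big; apply: eq_bigr => i _.
by rewrite -scaler_suml coef_sum.
Qed.

Lemma matching_polynomial_hstar : (0 < n)%N -> is_hstar P h.
Proof.
move=> n0 k; have := signed_gf e_sym e_irr e_noeven; rewrite card_ord => /ball_gf[fin gfh].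
rewrite (dim_succ_polytope R e n0) gfh; apply: eq_bigr => j _; congr (_ * _).
have cardE t : #|` fset_set (dilate_lattice_points P t)|%fset =
    #|` fset_set (ball (@signed_vectors _) (signed_norm e) t)|%fset.
  rewrite (dilate_lattice_pointsE R e_sym e_irr e_noeven t n0) card_fset_set_image //.
  by move=> u u' [Wu _] [Wu' _]; exact: signed_vec_inj.
rewrite -cardE; case: (k - j)%N => [|t] //.
(* The constant term of the Ehrhart series is 1 by convention; it agrees with the count for [t = 0]
   because [P] is nonempty. *)
suff -> : dilate_lattice_points P 0 = [set 0] by rewrite fset_set1 cardfs1.
have P0 := @zero_in_polytope R n e n0.
apply/seteqP; split=> z /=.
  move=> [y _]; rewrite scale0r => yz; apply/rowP => i; apply/eqP.
  by move/rowP: yz => /(_ i); rewrite !mxE -(eqr_int R) => <-.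
by move=> ->; exists 0 => //; rewrite scaler0 map_mx0.
Qed.

(** The polytope is empty, of dimension -1, so its series is the constant 1 with trivial
    denominator; the only matching is empty, so [h = 1]. *)
Lemma matching_polynomial_hstar0 : n = 0%N -> is_hstar P h.
Proof.
move=> n0; have noI (v : 'I_n) : False by case: v => v; rewrite n0.
have P0 x : ~ P x.
  move: x; apply: smallest_sub; first by apply/convex_setP.
  move=> _ [i [j [+ _]]]; rewrite /suspension.
  case: (unlift _ i) => [v|]; first by case: (noI v).
  by case: (unlift _ j) => [v|//]; case: (noI v).
have D0 : D = [set finset.set0]%SET.
  apply/finset.setP => A; rewrite finset.in_set1; apply/idP/eqP => [/(matching_card e_irr)|->].
    rewrite card_ord => A2; apply: cards0_eq; lia.
  exact: (proj1 (simplicial_matching_complex _)).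
have dim0 : dim_succ P = 0%N.
  apply/eqP; rewrite -leqn0; apply/bigmax_leqP => -[[|k] kN] //= /asboolP[X [PX _]].
  by case: (P0 _ (PX ord0)).
have -> : h = 1.
  by rewrite /h D0 big_set1 cards0 subn0 (_ : n = 0%N :> nat) // !expr0 mulr1.
move=> k; rewrite dim0 expr0 big_ord_recl subn0 coef1 mul1r big1 => [|j _]; last first.
  by rewrite coef1 mul0r.
rewrite addr0 coef1; case: k => [|k] //=.
rewrite (_ : dilate_lattice_points P k.+1 = set0) ?fset_set0 ?cardfs0 //.
by rewrite -subset0 => z [y Py]; case: (P0 _ Py).
Qed.

End MainTheorem.

Theorem theorem1p3 (R : realType) (n : nat) (e : rel 'I_n)
    (e_sym : symmetric e) (e_irr : irreflexive e)
    (e_noeven : no_even_cycle e) :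
  exists h g : {poly int},
    [/\ is_hstar (sym_edge_polytope R (suspension e)) h,
        is_gamma n h g
      & exists (T : finType) (D : {set {set T}}),
          [/\ simplicial_complex D, flag D & g = f_poly D]].
Proof.
exists (\sum_(A in matching_complex e) 'X^#|A| * (1 + 'X) ^+ (n - #|A|.*2))%R.
exists (f_poly (matching_complex e)); split.
- have [n0|n0] := posnP n; first exact: matching_polynomial_hstar0.
  exact: matching_polynomial_hstar.
- exact: matching_polynomial_gamma.
exists _, (matching_complex e); split=> //.
  exact: simplicial_matching_complex.
exact: flag_matching_complex.
Qed.
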